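(* Let $x_0\in\mathbb{R}^l$ be arbitrary, suppose that $T^{-1}(0)=(F+N)^{-1}(0)$ is nonempty, and let $\{x_k\}$ be generated by the FBstab algorithm (described in the context) with regularization parameters $\sigma_k>0$. Then $\{x_k\}\to x^*\in T^{-1}(0)$ as $k\to\infty$. Further, the convergence rate is at least linear and if, in addition, $\sigma_k\to 0$ as $k\to\infty$, then the convergence rate is superlinear.
   Context: Problem: the convex quadratic program $\min_z \frac12 z^THz+f^Tz$ subject to $Gz=h$, $Az\le b$, where $H=H^T\succeq0\in\mathbb{R}^{n\times n}$, $f\in\mathbb{R}^n$, $G\in\mathbb{R}^{m\times n}$, $h\in\mathbb{R}^m$, $A\in\mathbb{R}^{q\times n}$, $b\in\mathbb{R}^q$; no other assumptions on the data. Write $x=(z,\lambda,v)\in\mathbb{R}^n\times\mathbb{R}^m\times\mathbb{R}^q=\mathbb{R}^l$, $l=n+m+q$. The KKT conditions are equivalent to $T(x)=F(x)+N(x)\ni0$, where $$F(x)=Kx+w,\quad K=\begin{bmatrix}H&G^T&A^T\\-G&0&0\\-A&0&0\end{bmatrix},\quad w=\begin{bmatrix}f\\ h\\ b\end{bmatrix},$$ and $N(x)$ is the normal cone at $x$ of $C=\mathbb{R}^n\times\mathbb{R}^m\times\mathbb{R}^q_{\ge0}$: $N(x)=\{w'\mid\langle x-u,w'\rangle\ge0\ \forall u\in C\}$ if $x\in C$, and $N(x)=\emptyset$ otherwise. $T^{-1}(0)=\{x\mid 0\in T(x)\}$. $\|\cdot\|$ is the Euclidean norm. Natural residual: $\pi(x)=x-\Pi_C(x-F(x))$,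 with $\Pi_C$ the Euclidean projection onto $C$. Penalized Fischer-Burmeister function: for fixed $\alpha\in(0,1)$, $\phi(a,b)=\alpha(a+b-\sqrt{a^2+b^2})+(1-\alpha)a_+b_+$, where $a_+=\max(a,0)$. For $\bar x=(\bar z,\bar\lambda,\bar v)\in\mathbb{R}^l$, $\sigma>0$, set $$R(x,\bar x,\sigma)=\begin{bmatrix}Hz+f+G^T\lambda+A^Tv+\sigma(z-\bar z)\\ h-Gz+\sigma(\lambda-\bar\lambda)\\ \phi(y,v)\end{bmatrix},\quad y=b-Az+\sigma(v-\bar v),$$ with $\phi$ applied elementwise, and $\theta(x)=\frac12\|R(x,\bar x,\sigma)\|^2$. The C-subdifferential of $R(\cdot,\bar x,\sigma)$ at $x$ is $\bar\partial R=\partial R_1\times\dots\times\partial R_l$ (matrices whose $i$-th row belongs to the Clarke generalized gradient of the $i$-th component in $x$). Procedure EvalProx$(\bar x,\varepsilon,\sigma)$, with fixed parameters $\beta\in(0,1)$, $\eta\in(0,0.5)$: start from $x=\bar x$; repeat: compute $V\in\bar\partial R(x,\bar x,\sigma)$, solve $V\Delta x=-R(x,\bar x,\sigma)$, set $t=1$, and while $\theta(x+t\Delta x)\ge\theta(x)+\eta t\nabla\theta(x)^T\Delta x$ replace $t$ by $\beta t$; then set $x\leftarrow x+t\Delta x$; until $\|R(x,\bar x,\sigma)\|\le\varepsilon\min\{1,\|x-\bar x\|\}$. Return $x$. If a root of $R(\cdot,\bar x,\sigma)$ is reached within EvalProx, that root is returned. FBstab (outer loop), with parameter $\kappa\in(0,1)$,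 a sequence of positive numbers $\sigma_k$ and initial point $x_0$: set $\epsilon=\epsilon_0=\|\pi(x_0)\|$ and $\delta=\min(\epsilon_0/\sigma_0,1)$. For $k=0,1,2,\dots$: set $\delta\leftarrow\min(\kappa\delta,\epsilon/\delta)$ (this value is $\delta_k$), $x_{k+1}=$ EvalProx$(x_k,\delta_k\sigma_k,\sigma_k)$, $\epsilon\leftarrow\|\pi(x_{k+1})\|$. The sequence $\{x_k\}$ is the infinite sequence obtained when the outer termination tolerances and the infeasibility test are disregarded; if some $x_k\in T^{-1}(0)$ the algorithm stops and one sets $x_j=x_k$ for all $j\ge k$.
   Formalization: The regularization parameters σ_k are additionally assumed bounded above; without this the claim fails, e.g. for n=1, m=q=0, H=1, f=0, σ_k=2^k, x_0=1, where x_k tends to a positive limit while T^{-1}(0)={0}. *)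

(* Defs.v *)
From HB Require Import structures.
From mathcomp Require Import all_boot all_order all_algebra.
From mathcomp Require Import all_classical all_reals all_analysis.

Set Implicit Arguments.
Unset Strict Implicit.
Unset Printing Implicit Defensive.

Import Order.TTheory GRing.Theory Num.Theory.
Import numFieldNormedType.Exports.

Local Open Scope classical_set_scope.
Local Open Scope ring_scope.

Definition dotv (R : realType) (l : nat) (u v : 'cV[R]_l) : R :=
  \sum_(i < l) u i 0 * v i 0.

(* The library norm `|x| on 'cV[R]_l is the max norm, hence this definition. *)
Definition enorm (R : realType) (l : nat) (u : 'cV[R]_l) : R :=
  Num.sqrt (dotv u u).

Definition is_eproj (R : realType) (l : nat) (C : set 'cV[R]_l)
    (x p : 'cV[R]_l) : Prop :=
  C p /\ forall u, C u -> enorm (x - p) <= enorm (x - u).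

(* For C closed, convex and nonempty the set below is a singleton. *)
Definition eproj (R : realType) (l : nat) (C : set 'cV[R]_l)
    (x : 'cV[R]_l) : 'cV[R]_l :=
  get [set p | is_eproj C x p].

Definition normal_cone (R : realType) (l : nat) (C : set 'cV[R]_l)
    (x : 'cV[R]_l) : set 'cV[R]_l :=
  [set w | C x /\ forall u, C u -> 0 <= dotv (x - u) w].

Definition grad (R : realType) (l : nat) (f : 'cV[R]_l -> R)
    (x : 'cV[R]_l) : 'cV[R]_l :=
  \col_(i < l) 'D_(delta_mx i 0) f x.

Definition limiting_gradients (R : realType) (l : nat) (f : 'cV[R]_l -> R)
    (x : 'cV[R]_l) : set 'cV[R]_l :=
  [set g | exists u : nat -> 'cV[R]_l,
    [/\ forall k, differentiable f (u k),
        u @ \oo --> x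
      & (fun k => grad f (u k)) @ \oo --> g]].

(* Clarke's generalized gradient of a locally Lipschitz f : R^l -> R: the
   convex hull of the limits of gradients at differentiability points. *)
Definition clarke_gradient (R : realType) (l : nat) (f : 'cV[R]_l -> R)
    (x : 'cV[R]_l) : set 'cV[R]_l :=
  smallest (@convex_set R 'cV[R]_l) (limiting_gradients f x).

Definition C_subdifferential (R : realType) (l p : nat)
    (F : 'cV[R]_l -> 'cV[R]_p) (x : 'cV[R]_l) : set 'M[R]_(p, l) :=
  [set V | forall i : 'I_p,
    clarke_gradient (fun y => F y i 0) x (row i V)^T].

Record qp_data (R : realType) (n m q : nat) := QPData {
  qpH : 'M[R]_n;
  qpf : 'cV[R]_n;
  qpG : 'M[R]_(m, n);
  qph : 'cV[R]_m;
  qpA : 'M[R]_(q, n);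
  qpb : 'cV[R]_q }.

Definition convex_qp (R : realType) (n m q : nat) (P : qp_data R n m q) : Prop :=
  (qpH P)^T = qpH P /\ forall z : 'cV[R]_n, 0 <= dotv z (qpH P *m z).

(* Primal-dual vectors are stacked as x = (z, lambda, v). *)
Definition zpart (R : realType) (n m q : nat) (x : 'cV[R]_(n + m + q)) :
  'cV[R]_n := usubmx (usubmx x).
Definition lpart (R : realType) (n m q : nat) (x : 'cV[R]_(n + m + q)) :
  'cV[R]_m := dsubmx (usubmx x).
Definition vpart (R : realType) (n m q : nat) (x : 'cV[R]_(n + m + q)) :
  'cV[R]_q := dsubmx x.

Definition kktK (R : realType) (n m q : nat) (P : qp_data R n m q) :
    'M[R]_(n + m + q) :=
  block_mx (block_mx (qpH P) (qpG P)^T (- qpG P) 0) (col_mx (qpA P)^T 0)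
           (row_mx (- qpA P) 0)                     0.

Definition kktw (R : realType) (n m q : nat) (P : qp_data R n m q) :
    'cV[R]_(n + m + q) :=
  col_mx (col_mx (qpf P) (qph P)) (qpb P).

Definition kktF (R : realType) (n m q : nat) (P : qp_data R n m q)
    (x : 'cV[R]_(n + m + q)) : 'cV[R]_(n + m + q) :=
  kktK P *m x + kktw P.

Definition kktC (R : realType) (n m q : nat) : set 'cV[R]_(n + m + q) :=
  [set x | forall i : 'I_q, 0 <= vpart x i 0].

Definition kktT (R : realType) (n m q : nat) (P : qp_data R n m q)
    (x : 'cV[R]_(n + m + q)) : set 'cV[R]_(n + m + q) :=
  [set kktF P x + w | w in normal_cone (@kktC R n m q) x].

(* T^{-1}(0) *)
Definition kkt_zeros (R : realType) (n m q : nat) (P : qp_data R n m q) :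
    set 'cV[R]_(n + m + q) :=
  [set x | kktT P x 0].

Definition natural_residual (R : realType) (n m q : nat) (P : qp_data R n m q)
    (x : 'cV[R]_(n + m + q)) : 'cV[R]_(n + m + q) :=
  x - eproj (@kktC R n m q) (x - kktF P x).

Definition pfb (R : realType) (alpha a b : R) : R :=
  alpha * (a + b - Num.sqrt (a ^+ 2 + b ^+ 2))
  + (1 - alpha) * (Num.max a 0 * Num.max b 0).

Definition prox_res (R : realType) (n m q : nat) (P : qp_data R n m q)
    (alpha : R) (xbar : 'cV[R]_(n + m + q)) (sigma : R)
    (x : 'cV[R]_(n + m + q)) : 'cV[R]_(n + m + q) :=
  let: (z, lam, v) := (zpart x, lpart x, vpart x) in
  let y := qpb P - qpA P *m z + sigma *: (v - vpart xbar) in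
  col_mx
    (col_mx
      (qpH P *m z + qpf P + (qpG P)^T *m lam + (qpA P)^T *m v
         + sigma *: (z - zpart xbar))
      (qph P - qpG P *m z + sigma *: (lam - lpart xbar)))
    (\col_(i < q) pfb alpha (y i 0) (v i 0)).

Definition merit (R : realType) (n m q : nat) (P : qp_data R n m q)
    (alpha : R) (xbar : 'cV[R]_(n + m + q)) (sigma : R)
    (x : 'cV[R]_(n + m + q)) : R :=
  2^-1 * enorm (prox_res P alpha xbar sigma x) ^+ 2.

(* One pass through the body of the loop of EvalProx, from x to x'; j counts
   the backtracking steps.  A relation, since V need not be unique. *)
Definition newton_step (R : realType) (n m q : nat) (P : qp_data R n m q)
    (alpha beta eta : R) (xbar : 'cV[R]_(n + m + q)) (sigma : R)
    (x x' : 'cV[R]_(n + m + q)) : Prop :=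
  let theta := merit P alpha xbar sigma in
  exists (V : 'M[R]_(n + m + q)) (dx : 'cV[R]_(n + m + q)) (j : nat),
    let backtrack t :=
      theta (x + t *: dx) >= theta x + eta * t * dotv (grad theta x) dx in
    [/\ C_subdifferential (prox_res P alpha xbar sigma) x V,
        V *m dx = - prox_res P alpha xbar sigma x,
        forall i, (i < j)%N -> backtrack (beta ^+ i),
        ~ backtrack (beta ^+ j)
      & x' = x + beta ^+ j *: dx].

(* [evalprox_from ... x y]: the loop of EvalProx, currently at the iterate x,
   terminates and returns y.  The call EvalProx(xbar, eps, sigma) is the case
   x = xbar. *)
Inductive evalprox_from (R : realType) (n m q : nat) (P : qp_data R n m q)
    (alpha beta eta : R) (xbar : 'cV[R]_(n + m + q)) (eps sigma : R) :
    'cV[R]_(n + m + q) -> 'cV[R]_(n + m + q) -> Prop :=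
| EvalProxRoot x :
    prox_res P alpha xbar sigma x = 0 ->
    evalprox_from P alpha beta eta xbar eps sigma x x
| EvalProxStop x x' :
    prox_res P alpha xbar sigma x <> 0 ->
    newton_step P alpha beta eta xbar sigma x x' ->
    enorm (prox_res P alpha xbar sigma x')
      <= eps * Num.min 1 (enorm (x' - xbar)) ->
    evalprox_from P alpha beta eta xbar eps sigma x x'
| EvalProxNext x x' y :
    prox_res P alpha xbar sigma x <> 0 ->
    newton_step P alpha beta eta xbar sigma x x' ->
    ~ (enorm (prox_res P alpha xbar sigma x')
         <= eps * Num.min 1 (enorm (x' - xbar))) ->
    evalprox_from P alpha beta eta xbar eps sigma x' y ->
    evalprox_from P alpha beta eta xbar eps sigma x y.

Definition evalprox (R : realType) (n m q : nat) (P : qp_data R n m q)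
    (alpha beta eta : R) (xbar : 'cV[R]_(n + m + q)) (eps sigma : R)
    (y : 'cV[R]_(n + m + q)) : Prop :=
  evalprox_from P alpha beta eta xbar eps sigma xbar y.

(* The value of delta before the loop, where epsilon_0 = ||pi(x_0)||. *)
Definition fbstab_delta0 (R : realType) (n m q : nat) (P : qp_data R n m q)
    (sigma : nat -> R) (x : nat -> 'cV[R]_(n + m + q)) : R :=
  Num.min (enorm (natural_residual P (x 0%N)) / sigma 0%N) 1.

(* delta_k; at the start of iteration k the variable epsilon is ||pi(x_k)||. *)
Fixpoint fbstab_delta (R : realType) (n m q : nat) (P : qp_data R n m q)
    (kappa : R) (sigma : nat -> R) (x : nat -> 'cV[R]_(n + m + q)) (k : nat) :
    R :=
  let d := if k is k'.+1 then fbstab_delta P kappa sigma x k'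
           else fbstab_delta0 P sigma x in
  Num.min (kappa * d) (enorm (natural_residual P (x k)) / d).

Definition fbstab_sequence (R : realType) (n m q : nat) (P : qp_data R n m q)
    (alpha beta eta kappa : R) (sigma : nat -> R)
    (x0 : 'cV[R]_(n + m + q)) (x : nat -> 'cV[R]_(n + m + q)) : Prop :=
  x 0%N = x0 /\
  forall k,
    (kkt_zeros P (x k) -> x k.+1 = x k) /\
    (~ kkt_zeros P (x k) ->
       evalprox P alpha beta eta (x k)
         (fbstab_delta P kappa sigma x k * sigma k) (sigma k) (x k.+1)).

(* Q-linear and Q-superlinear convergence rates in the Euclidean norm, in
   quotient-free form so that sequences reaching their limit are covered. *)
Definition linear_rate (R : realType) (l : nat) (u : nat -> 'cV[R]_l)
    (a : 'cV[R]_l) : Prop :=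
  exists2 r : R, 0 < r < 1 &
    \forall k \near \oo, enorm (u k.+1 - a) <= r * enorm (u k - a).

Definition superlinear_rate (R : realType) (l : nat) (u : nat -> 'cV[R]_l)
    (a : 'cV[R]_l) : Prop :=
  forall r : R, 0 < r ->
    \forall k \near \oo, enorm (u k.+1 - a) <= r * enorm (u k - a).

(* Main.v *)
Require Import Defs.
From HB Require Import structures.
From mathcomp Require Import all_boot all_order all_algebra.
From mathcomp Require Import all_classical all_reals all_analysis.
From mathcomp Require Import ring lra.

Set Implicit Arguments.
Unset Strict Implicit.
Unset Printing Implicit Defensive.

Import Order.TTheory GRing.Theory Num.Theory.
Import numFieldNormedType.Exports.

Local Open Scope classical_set_scope.
Local Open Scope ring_scope.

(* FBstab is an inexact proximal point method: x_{k+1} differs by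
   O(kappa^k |x_{k+1} - x_k|) from a point p_k with
   w_k = sigma_k (x_k + u_k - p_k) in T(p_k), where u_k is equally small, because
   |min(a,b)| is bounded by the penalized Fischer-Burmeister function.  The
   Newton direction plays no role, only the exit test of EvalProx.

   Monotonicity of T gives |p_k - z|^2 + |x_k + u_k - p_k|^2 <= |x_k + u_k - z|^2
   for all zeros z, so w_k -> 0.  As T is polyhedral, a Hoffman-type bound yields
   zeros z_k with |p_k - z_k| <= a |w_k|, so (x_k) is Cauchy with limit xs in
   T^{-1}(0).  Fejer monotonicity up to a factor gives
   |x_k - xs| <= 3 |x_k - z| for every zero z.  Hence |x_k - xs| is
   O(|x_k + u_k - p_k|), which in the displayed inequality with z = xs yields the
   Q-linear rate at xs itself; and |x_{k+1} - xs| <= 3 |x_{k+1} - z_k|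
   <= (o(1) + O(sigma_k)) |x_k - xs| yields the superlinear rate. *)

(** * The Euclidean norm *)

Lemma dotvC (R : realType) l (u v : 'cV[R]_l) : dotv u v = dotv v u.
Proof. by apply: eq_bigr => i _; rewrite mulrC. Qed.

Lemma dotvDl (R : realType) l (u v w : 'cV[R]_l) :
  dotv (u + v) w = dotv u w + dotv v w.
Proof. by rewrite -big_split; apply: eq_bigr => i _; rewrite mxE mulrDl. Qed.

Lemma dotvZl (R : realType) l (a : R) (u v : 'cV[R]_l) :
  dotv (a *: u) v = a * dotv u v.
Proof. by rewrite mulr_sumr; apply: eq_bigr => i _; rewrite mxE mulrA. Qed.

Lemma dotvNl (R : realType) l (u v : 'cV[R]_l) : dotv (- u) v = - dotv u v.
Proof. by rewrite -scaleN1r dotvZl mulN1r. Qed.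

Lemma dotvDr (R : realType) l (u v w : 'cV[R]_l) :
  dotv u (v + w) = dotv u v + dotv u w.
Proof. by rewrite dotvC dotvDl !(dotvC u). Qed.

Lemma dotvZr (R : realType) l (a : R) (u v : 'cV[R]_l) :
  dotv u (a *: v) = a * dotv u v.
Proof. by rewrite dotvC dotvZl dotvC. Qed.

Lemma dotvNr (R : realType) l (u v : 'cV[R]_l) : dotv u (- v) = - dotv u v.
Proof. by rewrite dotvC dotvNl dotvC. Qed.

Lemma dotv_ge0 (R : realType) l (u : 'cV[R]_l) : 0 <= dotv u u.
Proof. by apply: sumr_ge0 => i _; rewrite -expr2 sqr_ge0. Qed.

Lemma enorm_ge0 (R : realType) l (u : 'cV[R]_l) : 0 <= enorm u.
Proof. exact: sqrtr_ge0. Qed.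

Lemma sqr_enorm (R : realType) l (u : 'cV[R]_l) : enorm u ^+ 2 = dotv u u.
Proof. by rewrite sqr_sqrtr // dotv_ge0. Qed.

Lemma enormN (R : realType) l (u : 'cV[R]_l) : enorm (- u) = enorm u.
Proof. by rewrite /enorm dotvNl dotvNr opprK. Qed.

Lemma enorm_distC (R : realType) l (u v : 'cV[R]_l) :
  enorm (u - v) = enorm (v - u).
Proof. by rewrite -enormN opprB. Qed.

Lemma enorm0 (R : realType) l : enorm (0 : 'cV[R]_l) = 0.
Proof. by rewrite /enorm -(scale0r 0) dotvZl mul0r sqrtr0. Qed.

Lemma enormZ (R : realType) l (a : R) (u : 'cV[R]_l) :
  enorm (a *: u) = `|a| * enorm u.
Proof.
by rewrite /enorm dotvZl dotvZr mulrA -expr2 sqrtrM ?sqr_ge0 // sqrtr_sqr.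
Qed.

(** Cauchy-Schwarz, from nonnegativity of [enorm (a *: u + b *: v) ^+ 2] at well-chosen [a] and [b];
    the weights [enorm v] and [- enorm u] do unless a norm vanishes. *)
Lemma dotv_le_enorm (R : realType) l (u v : 'cV[R]_l) :
  dotv u v <= enorm u * enorm v.
Proof.
have H (a b : R) : 0 <= a ^+ 2 * dotv u u + 2 * (a * b * dotv u v)
    + b ^+ 2 * dotv v v.
  have := dotv_ge0 (a *: u + b *: v).
  rewrite !(dotvDl, dotvDr, dotvZl, dotvZr) (dotvC v u); lra.
rewrite -!sqr_enorm in H.
have := enorm_ge0 u; have := enorm_ge0 v.
rewrite [0 <= enorm v]le_eqVlt => /predU1P[v0|v0] u0.
  rewrite -v0 mulr0.
  have := H (- dotv u v) (enorm u ^+ 2 + 1); rewrite -v0.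
  have : 0 <= enorm u ^+ 2 by rewrite sqr_ge0.
  move: (dotv u v) (enorm u ^+ 2) => d U U0 H1.
  have [//|d0] := leP d 0.
  nra.
move: u0; rewrite le_eqVlt => /predU1P[u0|u0].
  rewrite -u0 mul0r.
  have := H (enorm v ^+ 2 + 1) (- dotv u v); rewrite -u0.
  have : 0 <= enorm v ^+ 2 by rewrite sqr_ge0.
  move: (dotv u v) (enorm v ^+ 2) => d U U0 H1.
  have [//|d0] := leP d 0.
  nra.
have H1 := H (enorm v) (- enorm u).
have uv := mulr_gt0 u0 v0.
rewrite -(ler_pM2l uv).
nra.
Qed.

Lemma sqr_enormD (R : realType) l (u v : 'cV[R]_l) :
  enorm (u + v) ^+ 2 = enorm u ^+ 2 + 2 * dotv u v + enorm v ^+ 2.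
Proof. by rewrite !sqr_enorm !(dotvDl, dotvDr) (dotvC v u); ring. Qed.

Lemma enormD_le (R : realType) l (u v : 'cV[R]_l) :
  enorm (u + v) <= enorm u + enorm v.
Proof.
rewrite -(@ler_pXn2r _ 2) ?nnegrE ?addr_ge0 ?enorm_ge0 //.
rewrite sqr_enormD; have := dotv_le_enorm u v; nra.
Qed.

Lemma enorm_dist_le (R : realType) l (w u v : 'cV[R]_l) :
  enorm (u - v) <= enorm (u - w) + enorm (w - v).
Proof. by have := enormD_le (u - w) (w - v); rewrite subrKA. Qed.

Lemma coord_le_enorm (R : realType) l (u : 'cV[R]_l) i : `|u i 0| <= enorm u.
Proof.
rewrite -sqrtr_sqr ler_wsqrtr // /dotv (bigD1 i) //= -expr2 lerDl.
by apply: sumr_ge0 => j _; rewrite -expr2 sqr_ge0.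
Qed.

Lemma enorm_le_coord (R : realType) l (u : 'cV[R]_l) (e : R) :
  (forall i, `|u i 0| <= e) -> enorm u <= l%:R * e.
Proof.
case: l u => [|l] u ue.
  by rewrite /enorm /dotv big_ord0 sqrtr0 mul0r.
have e0 : 0 <= e := le_trans (normr_ge0 _) (ue ord0).
rewrite -[l.+1%:R * e]ger0_norm ?mulr_ge0 // -sqrtr_sqr ler_wsqrtr //.
apply: (@le_trans _ _ (\sum_(i < l.+1) e ^+ 2)).
  by apply: ler_sum => i _; rewrite -expr2 -real_normK ?num_real // lerXn2r ?nnegrE.
rewrite sumr_const card_ord exprMn -[_ *+ l.+1]mulr_natl ler_wpM2r ?sqr_ge0 //.
by rewrite -natrX ler_nat -[leqLHS]expn1 leq_pexp2l.
Qed.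

Lemma enorm_mulmx_le (R : realType) l (K : 'M[R]_l) :
  exists2 c : R, 0 <= c & forall u : 'cV[R]_l, enorm (K *m u) <= c * enorm u.
Proof.
pose s : R := \sum_i \sum_j `|K i j|.
have s0 : 0 <= s by apply: sumr_ge0 => i _; apply: sumr_ge0.
exists (l%:R * s) => [|u]; first by rewrite mulr_ge0.
rewrite -mulrA; apply: enorm_le_coord => i; rewrite mxE.
apply: le_trans (ler_norm_sum _ _ _) _.
rewrite /s mulr_suml [leRHS](bigD1 i) //= mulr_suml ler_wpDr //.
  by apply: sumr_ge0 => j _; rewrite mulr_ge0 ?enorm_ge0 ?sumr_ge0.
by apply: ler_sum => j _; rewrite normrM ler_wpM2l // coord_le_enorm.
Qed.

(** * Error bounds for polyhedral systems *)

(** Clip [t] to the interval between the largest [l] and the smallest [u]. Each bound is violated by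
    at most [d], so clipping moves [t] by at most [d]. *)
Lemma exists_between_near (R : realType) (I : finType) (A B : pred I)
    (u l : I -> R) (t d : R) : 0 <= d ->
  (forall i k, A i -> B k -> l k <= u i) ->
  (forall i, A i -> t - d <= u i) -> (forall k, B k -> l k <= t + d) ->
  exists t', [/\ forall i, A i -> t' <= u i, forall k, B k -> l k <= t'
              & `|t - t'| <= d].
Proof.
move=> d0 lu tu lt.
pose s := \big[Num.min/t]_(i | A i) u i.
exists (\big[Num.max/s]_(k | B k) l k); split => [i Ai|k Bk|].
- apply: bigmax_le => [|k Bk]; last exact: lu.
  exact: bigmin_le_cond.
- exact: le_bigmax_cond.
rewrite ler_distlC; apply/andP; split.
  apply: le_trans (bigmax_ge_id _ _ _ _).
  apply: le_bigmin => //; lra.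
apply: bigmax_le => //; apply: le_trans (_ : t <= _); last lra.
exact: bigmin_le_id.
Qed.

Lemma sum_le_single (R : realType) (I : finType) (F : I -> R) i :
  (forall j, 0 <= F j) -> F i <= \sum_j F j.
Proof. by move=> F0; rewrite (bigD1 i) //= lerDl sumr_ge0. Qed.

(* Hoffman's bound, by Fourier-Motzkin elimination of the last variable.  The
   threshold [tau] makes the statement cover infeasible systems, which have no
   approximate solutions. *)
Lemma affine_system_error_bound (R : realType) (n : nat) (I : finType)
    (a : I -> nat -> R) (c : I -> R) :
  exists K tau : R, [/\ 0 <= K, 0 < tau & forall (e : R) (x : nat -> R),
    0 <= e < tau -> (forall i, \sum_(j < n) a i j * x j + c i <= e) ->
    exists x' : nat -> R,
      (forall i, \sum_(j < n) a i j * x' j + c i <= 0) /\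
      (forall j, (j < n)%N -> `|x j - x' j| <= K * e)].
Proof.
elim: n => [|n IHn] in I a c *.
  (* Without variables, an error below the smallest positive constant forces every constant to be
     nonpositive. *)
  exists 0, (\big[Num.min/1]_(i | 0 < c i) c i); split => //.
    exact: lt_bigmin.
  move=> e x /andP[e0 etau] xe; exists x; split=> // i.
  have := xe i; rewrite !big_ord0 !add0r => cie.
  rewrite leNgt; apply/negP => ci0.
  have := lt_le_trans etau (bigmin_le_cond 1 c ci0); lra.
pose p i := a i n.
(* Rows free of the last variable are kept ([inl]); a row with positive and one with negative last
   coefficient are combined with positive weights to cancel it ([inr]). All other indices give the
   zero row. *)
pose a' (ik : I + I * I) j := match ik with
  | inl i => if p i == 0 then a i j else 0
  | inr (i, k) => if (0 < p i) && (p k < 0) then p i * a k j - p k * a i j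
                  else 0
  end.
pose c' (ik : I + I * I) := match ik with
  | inl i => if p i == 0 then c i else 0
  | inr (i, k) => if (0 < p i) && (p k < 0) then p i * c k - p k * c i else 0
  end.
have [K [tau [K0 tau0 IH]]] := IHn _ a' c'.
pose S i y := \sum_(j < n) a i j * y j + c i.
have Sl i y : \sum_(j < n) a' (inl i) j * y j + c' (inl i)
    = if p i == 0 then S i y else 0.
  rewrite /a' /c'; case: eqP => // _.
  by rewrite addr0 big1 // => j _; rewrite mul0r.
have Sr i k y : \sum_(j < n) a' (inr (i, k)) j * y j + c' (inr (i, k))
    = if (0 < p i) && (p k < 0) then p i * S k y - p k * S i y else 0.
  rewrite /a' /c' /S; case: ifP => // _; last first.
    by rewrite addr0 big1 // => j _; rewrite mul0r.
  rewrite !mulrDr opprD addrACA !mulr_sumr -sumrB; congr (_ + _).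
  by apply: eq_bigr => j _; ring.
pose s : R := \sum_i `|p i|.
have s0 : 0 <= s by apply: sumr_ge0.
have ps i : `|p i| <= s by apply: (sum_le_single (F := fun i => `|p i|)).
(* An error [e] in the rows becomes at most [M * e] in the eliminated system, whose weights are at
   most [s]. *)
pose M := 1 + 2 * s.
pose W : R := \sum_i `|p i|^-1.
have W0 : 0 <= W by apply: sumr_ge0 => i _; rewrite invr_ge0.
have pW i : `|p i|^-1 <= W.
  by apply: (sum_le_single (F := fun i => `|p i|^-1)) => j; rewrite invr_ge0.
pose L : R := \sum_i \sum_(j < n) `|a i j|.
have L0 : 0 <= L by apply: sumr_ge0 => i _; apply: sumr_ge0.
have aL i : \sum_(j < n) `|a i j| <= L.
  by apply: (sum_le_single (F := fun i => \sum_(j < n) `|a i j|)) => j; apply: sumr_ge0.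
have M0 : 0 < M by rewrite /M; lra.
(* Moving the first [n] variables by [K * M * e] leaves row errors of at most
   [(1 + L * (K * M)) * e]; solving a row for the last variable costs a further factor [W]. *)
pose D := W * (1 + L * (K * M)).
have LKM0 : 0 <= L * (K * M) by rewrite !mulr_ge0 // ltW.
have D0 : 0 <= D by rewrite mulr_ge0 //; lra.
exists (K * M + D), (tau / M); split.
- by rewrite addr_ge0 // mulr_ge0 // ltW.
- by rewrite divr_gt0.
move=> e x /andP[e0 etau] xe.
have {}xe i : S i x + p i * x n <= e.
  by apply: le_trans (xe i); rewrite big_ord_recr /= -/(p i) /S; lra.
have Me : 0 <= M * e < tau.
  by rewrite mulr_ge0 ?(ltW M0) //= mulrC -ltr_pdivlMr.
have [[i|[i k]]|x' [x'0 xx']] := IH _ x Me.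
- rewrite Sl; case: eqP => [pi0|_]; last by case/andP: Me.
  have := xe i; rewrite pi0 mul0r addr0 => /le_trans; apply.
  by rewrite ler_peMl // /M; lra.
- rewrite Sr; case: ifP => [/andP[pi0 pk0]|_]; last by case/andP: Me.
  have := xe i; have := xe k; have := ps i; have := ps k.
  rewrite (gtr0_norm pi0) (ltr0_norm pk0) /M.
  move: (S i x) (S k x) (p i) (p k) pi0 pk0 => Si Sk pi pk pi0 pk0 h1 h2 h3 h4.
  have h5 : pi * (Sk + pk * x n) <= pi * e by rewrite ler_pM2l.
  have h6 : - pk * (Si + pi * x n) <= - pk * e by rewrite ler_pM2l; lra.
  have h7 : pi * e <= s * e by rewrite ler_wpM2r.
  have h8 : - pk * e <= s * e by rewrite ler_wpM2r.
  nra.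
have Se i : S i x' + p i * x n <= (1 + L * (K * M)) * e.
  have : S i x' - S i x <= L * (K * (M * e)).
    rewrite /S opprD addrACA subrr addr0 -sumrB.
    apply: le_trans (_ : \sum_(j < n) `|a i j| * (K * (M * e)) <= _).
      apply: ler_sum => j _; rewrite -mulrBr (le_trans (ler_norm _)) // normrM.
      by rewrite ler_wpM2l // distrC xx'.
    by rewrite -mulr_suml ler_wpM2r // mulr_ge0 //; case/andP: Me.
  have := xe i; lra.
have x'l i : p i = 0 -> S i x' <= 0.
  by move=> pi0; have := x'0 (inl i); rewrite Sl pi0 eqxx.
have x'r i k : 0 < p i -> p k < 0 -> p i * S k x' - p k * S i x' <= 0.
  by move=> pi0 pk0; have := x'0 (inr (i, k)); rewrite Sr pi0 pk0.
have eLKM0 : 0 <= (1 + L * (K * M)) * e by rewrite mulr_ge0 //; lra.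
(* Rows with [p i > 0] bound the last variable from above, rows with [p i < 0] from below; the
   combined rows say that these bounds are compatible. *)
have [|i k pi0 pk0|i pi0|k pk0|t [tu tl xt]] :=
  @exists_between_near R I (fun i => 0 < p i) (fun i => p i < 0)
  (fun i => - (S i x' / p i)) (fun i => - (S i x' / p i)) (x n) (D * e).
- by rewrite mulr_ge0.
- rewrite lerN2 ler_pdivrMr // mulrAC ler_ndivlMr //.
  have := x'r _ _ pi0 pk0; lra.
- have := Se i; have := pW i; rewrite (gtr0_norm pi0) => Wi Sei.
  rewrite lerNr ler_pdivrMr //.
  have : (1 + L * (K * M)) * e <= D * e * p i.
    rewrite (_ : D * e * p i = W * p i * ((1 + L * (K * M)) * e)); last first.
      by rewrite /D; ring.
    rewrite -[leLHS]mul1r ler_wpM2r //.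
    by rewrite mulrC -ler_pdivrMl // mulr1.
  lra.
- have := Se k; have := pW k; rewrite (ltr0_norm pk0) => Wk Sek.
  rewrite lerNl ler_ndivlMr //.
  have : (1 + L * (K * M)) * e <= D * e * - p k.
    rewrite (_ : D * e * - p k = W * (- p k) * ((1 + L * (K * M)) * e)); last first.
      by rewrite /D; ring.
    rewrite -[leLHS]mul1r ler_wpM2r //.
    by rewrite mulrC -ler_pdivrMl ?oppr_gt0 // mulr1.
  lra.
exists (fun j => if j == n then t else x' j); split=> [i|j].
  rewrite big_ord_recr /= eqxx -/(p i).
  have -> : \sum_(j < n) a i j * (if j == n :> nat then t else x' j)
     = \sum_(j < n) a i j * x' j.
    by apply: eq_bigr => j _; rewrite (ltn_eqF (ltn_ord j)).
  rewrite addrAC -/(S i x').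
  have [pi0|pi0|pi0] := ltrgtP (p i) 0.
  - by have := tl i pi0; rewrite lerNl ler_ndivlMr //; lra.
  - by have := tu i pi0; rewrite lerNr ler_pdivrMr //; lra.
  - by rewrite pi0 mul0r addr0 x'l.
case: eqP => [-> _|/eqP jn].
  have : 0 <= K * M * e by rewrite !mulr_ge0 // ltW.
  by move=> ?; apply: le_trans xt _; lra.
rewrite ltnS leq_eqVlt (negbTE jn) /= => {}jn.
have : 0 <= D * e by rewrite mulr_ge0.
move=> ?; apply: le_trans (xx' j jn) _; lra.
Qed.

(** Mixed linear complementarity problem: the coordinatewise form of the inclusion of [w] in
    [K *m x + c] plus the normal cone at [x] of the set where the coordinates in [J] are
    nonnegative. *)
Definition mlcp (R : realType) (l : nat) (J : pred 'I_l) (K : 'M[R]_l)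
    (c w x : 'cV[R]_l) : Prop :=
  let g := K *m x + c - w in
  forall k, if J k then [/\ 0 <= x k 0, 0 <= g k 0 & x k 0 * g k 0 = 0]
            else g k 0 = 0.

(* The solution set is the union, over the sets of indices where the
   complementary slack vanishes, of finitely many polyhedra. *)
Lemma mlcp_error_bound (R : realType) (l : nat) (J : pred 'I_l) (K : 'M[R]_l)
    (c : 'cV[R]_l) :
  exists a tau : R, [/\ 0 <= a, 0 < tau & forall w x : 'cV[R]_l,
    mlcp J K c w x -> enorm w < tau ->
    exists2 z, mlcp J K c 0 z & enorm (x - z) <= a * enorm w].
Proof.
pose ext (f : 'I_l -> R) (j : nat) := oapp f 0 (insub j).
have extE f (j : 'I_l) : ext f j = f j by rewrite /ext valK.
(* Row [(k, b, s)] concerns the slack if [b], else the variable; it demands a value at least 0 if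
   [s], else at most 0. The set [I] prescribes where the slack vanishes; off [I] the variable must
   vanish. *)
pose active (I : {set 'I_l}) (r : 'I_l * bool * bool) := let: (k, b, s) := r in
  if b then s || ~~ J k || (k \in I) else J k && (s || (k \notin I)).
pose sg (s : bool) : R := if s then -1 else 1.
pose A I (r : 'I_l * bool * bool) := let: (k, b, s) := r in
  ext (fun j => if active I r then sg s * (if b then K k j else (j == k)%:R)
                else 0).
pose C I (r : 'I_l * bool * bool) := let: (k, b, s) := r in
  if active I r && b then sg s * c k 0 else 0.
have rowE I k b s (x : 'cV[R]_l) :
    \sum_(j < l) A I (k, b, s) j * x j 0 + C I (k, b, s)
    = if active I (k, b, s) then
        sg s * (if b then (K *m x + c) k 0 else x k 0)
      else 0.
  rewrite /A /C; case: (active I _) => /=; last first.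
    by rewrite addr0 big1 // => j _; rewrite extE mul0r.
  case: b; last first.
    rewrite addr0 (bigD1 k) //= extE eqxx mulr1 big1 ?addr0 // => j jk.
    by rewrite extE (negbTE jk) mulr0 mul0r.
  rewrite !mxE mulrDr mulr_sumr; congr (_ + _).
  by apply: eq_bigr => j _; rewrite extE mulrA.
have /choice[a] I := affine_system_error_bound l (A I) (C I).
move=> /choice[tau] H.
(* There are finitely many sets [I], so the sum and the minimum give constants valid for all of
   them. *)
exists (l%:R * \sum_I a I), (\big[Num.min/1]_I tau I); split.
- by rewrite mulr_ge0 // sumr_ge0 // => I _; case: (H I).
- by apply: lt_bigmin => // I _; case: (H I).
move=> w x xw wtau.
pose g := K *m x + c - w.
have gE : K *m x + c = g + w by rewrite subrK.
(* For this [I], complementarity makes [x] satisfy all active rows up to the size of [w]. *)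
pose I : {set 'I_l} := [set k | g k 0 == 0]%SET.
have [aI0 tauI0 HI] := H I.
have wk k : - enorm w <= w k 0 <= enorm w.
  by rewrite -ler_norml coord_le_enorm.
have w0 := enorm_ge0 w.
have ext_sum r (y : nat -> R) : \sum_(j < l) A I r j * y j
   = \sum_(j < l) A I r j * (\col_(j < l) y j) j 0.
  by apply: eq_bigr => j _; rewrite mxE.
have [||x' [x'0 xx']] := HI (enorm w) (ext (fun j => x j 0)).
- by rewrite w0 /=; apply: lt_le_trans wtau (bigmin_le_cond _ _ _).
- case=> [[k b] s]; rewrite ext_sum.
  rewrite (_ : \col__ _ = x); last by apply/colP => j; rewrite mxE extE.
  rewrite rowE; case: ifP => // act.
  have := xw k; rewrite -/g /= in act *.
  rewrite gE [(g + w) k 0]mxE; case/andP: (wk k).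
  case: b act => /=; rewrite /I inE.
    case: (J k) => /=; last first.
      by move=> _ ? ? ->; case: s; rewrite /sg; lra.
    by rewrite orbF; case: s => /= [_ ? ? [] ?|/eqP-> ? ? _]; rewrite /sg; lra.
  case: (J k) => //=; case: s => /= [_ ? ? [] ?|/negP gk ? ? [_ _]].
    by rewrite /sg; lra.
  by move=> /eqP; rewrite mulf_eq0 => /orP[/eqP ->|//]; rewrite /sg; lra.
pose z := \col_(j < l) x' j.
have zI k b s : active I (k, b, s) ->
    sg s * (if b then (K *m z + c) k 0 else z k 0) <= 0.
  by move=> act; have := x'0 (k, b, s); rewrite ext_sum rowE act.
exists z.
  move=> k; rewrite subr0.
  have := zI k true true isT; have := zI k true false.
  have := zI k false true; have := zI k false false; rewrite /sg /=.
  case: (J k) => /=; last first.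
    by move=> _ _ /(_ isT) ? ?; apply/le_anti/andP; split; lra.
  case: (k \in I) => /=.
    move=> _ /(_ isT) ? /(_ isT) ? ?.
    have -> : (K *m z + c) k 0 = 0 by apply/le_anti/andP; split; lra.
    by split; rewrite ?mulr0 //; lra.
  move=> /(_ isT) ? /(_ isT) ? _ ?.
  have -> : z k 0 = 0 by apply/le_anti/andP; split; lra.
  by split; rewrite ?mul0r //; lra.
rewrite -mulrA; apply: enorm_le_coord => j.
rewrite [(x - z) j 0]mxE mxE mxE.
have := xx' j (ltn_ord j); rewrite extE => /le_trans; apply.
rewrite ler_wpM2r //; apply: (sum_le_single (F := a)) => I'.
by case: (H I').
Qed.

(** The matrix part is monotone, and by complementarity the product of [x - x'] with the slack
    difference reduces to nonpositive cross terms. *)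
Lemma mlcp_monotone (R : realType) (l : nat) (J : pred 'I_l) (K : 'M[R]_l)
    (c w w' x x' : 'cV[R]_l) : (forall u, 0 <= dotv u (K *m u)) ->
  mlcp J K c w x -> mlcp J K c w' x' -> 0 <= dotv (x - x') (w - w').
Proof.
move=> Kmon xw xw'.
set g := K *m x + c - w; set g' := K *m x' + c - w'.
have -> : w - w' = K *m (x - x') - (g - g').
  by rewrite mulmxBr; apply/colP => k; rewrite !mxE; ring.
rewrite dotvDr dotvNr; apply: addr_ge0 => //; rewrite oppr_ge0.
apply: sumr_le0 => k _.
have subE (u v : 'cV[R]_l) : (u - v) k 0 = u k 0 - v k 0 by rewrite !mxE.
rewrite (subE x) (subE g).
have := xw k; have := xw' k; rewrite -/g -/g'.
case: (J k) => [[x0 g0 xg] [x0' g0' xg']|-> ->]; last first.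
  by rewrite subr0 mulr0.
have := mulr_ge0 x0 g0'; have := mulr_ge0 x0' g0; lra.
Qed.

(** Variables and slacks depend continuously on the point, so signs and equations pass to the
    limit. *)
Lemma mlcp_closed (R : realType) (l : nat) (J : pred 'I_l) (K : 'M[R]_l)
    (c w x : 'cV[R]_l) :
  (forall e : R, 0 < e -> exists2 z, mlcp J K c w z & enorm (x - z) < e) ->
  mlcp J K c w x.
Proof.
move=> near_x g k; have [B B0 KB] := enorm_mulmx_le K.
have {near_x} near_k (e : R) : 0 < e -> exists2 z, mlcp J K c w z &
    `|x k 0 - z k 0| <= e /\ `|g k 0 - (K *m z + c - w) k 0| <= e.
  move=> e0; have B1 : 0 < B + 1 by lra.
  have [z zw xz] := near_x (e / (B + 1)) (divr_gt0 e0 B1).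
  have subE (u v : 'cV[R]_l) : u k 0 - v k 0 = (u - v) k 0 by rewrite !mxE.
  have xz0 := enorm_ge0 (x - z).
  move: xz; rewrite ltr_pdivlMr // => xz.
  exists z; rewrite // !{}subE; split.
    by apply: le_trans (coord_le_enorm _ _) _; nra.
  have -> : g - (K *m z + c - w) = K *m (x - z).
    by rewrite /g mulmxBr; apply/colP => j; rewrite !mxE; ring.
  by apply: le_trans (coord_le_enorm _ _) _; have := KB (x - z); nra.
case Jk: (J k); last first.
  apply/eqP; rewrite -normr_le0; apply/ler_addgt0Pr => e e0.
  have [z /(_ k)] := near_k e e0.
  by rewrite Jk => -> [_]; rewrite subr0 add0r.
split.
- apply/ler_addgt0Pr => e e0; have [z /(_ k)] := near_k e e0.
  by rewrite Jk ler_norml => -[? _ _] [/andP[? ?] _]; lra.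
- apply/ler_addgt0Pr => e e0; have [z /(_ k)] := near_k e e0.
  by rewrite Jk !ler_norml => -[_ ? _] [_ /andP[? ?]]; lra.
apply/eqP; rewrite -normr_eq0 normrM; apply/eqP.
have [->|x0] := eqVneq `|x k 0| 0; first by rewrite mul0r.
have [->|g0] := eqVneq `|g k 0| 0; first by rewrite mulr0.
have x1 : 0 < `|x k 0| by rewrite lt0r x0 normr_ge0.
have g1 : 0 < `|g k 0| by rewrite lt0r g0 normr_ge0.
(* At this distance a nearby solution would have variable and slack both nonzero, against
   complementarity. *)
pose e := Num.min `|x k 0| `|g k 0| / 2.
have e0 : 0 < e by rewrite divr_gt0 // lt_min x1 g1.
have ex : e < `|x k 0|.
  by have : e * 2 <= `|x k 0|; [rewrite divfK // ge_min lexx | lra].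
have eg : e < `|g k 0|.
  by have : e * 2 <= `|g k 0|; [rewrite divfK // ge_min lexx orbT | lra].
have [z /(_ k)] := near_k e e0.
rewrite Jk => -[_ _ /eqP]; rewrite mulf_eq0 => /orP[] /eqP-> [].
  by rewrite subr0; lra.
by rewrite subr0; lra.
Qed.

(** * Inexact proximal point iterations *)

(** A nonincreasing sequence bounded below converges, so its decrements, which dominate [q k ^+ 2],
    tend to 0. *)
Lemma telescoping_bound_to0 (R : realType) (b q : nat -> R) :
  (forall k, 0 <= b k) -> (forall k, q k ^+ 2 <= b k - b k.+1) ->
  forall e, 0 < e -> exists N, forall k, (N <= k)%N -> q k < e.
Proof.
move=> b0 qb e e0.
have b_dec k : b k.+1 <= b k by have := qb k; have := sqr_ge0 (q k); lra.
have : cvgn b.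
  apply: nonincreasing_is_cvgn; first exact/nonincreasing_seqP.
  by exists 0 => _ [k _ <-].
move=> /cvgrPdist_lt /(_ (e ^+ 2 / 2)) [|N _ HN].
  by rewrite divr_gt0 // exprn_gt0.
exists N => k Nk; have := HN k Nk; have := HN k.+1 (leqW Nk).
rewrite /= !ltr_norml => /andP[? ?] /andP[? ?].
rewrite ltNge; apply/negP => eq.
have : e ^+ 2 <= q k ^+ 2 by rewrite lerXn2r ?nnegrE // ltW // (lt_le_trans e0).
have := qb k; lra.
Qed.

Lemma enorm_cvg (R : realType) l (x : nat -> 'cV[R]_l) (y : 'cV[R]_l) :
  x @ \oo --> y -> forall e, 0 < e ->
  exists N, forall k, (N <= k)%N -> enorm (x k - y) < e.
Proof.
move=> /cvg_ballP xy e e0.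
(* Passing from the max norm costs a factor [l]; dividing by [l.+1] also covers dimension 0 and
   keeps the bound strict. *)
have l0 : 0 < (l.+1%:R : R) by [].
have [N _ HN] := xy (e / l.+1%:R) (divr_gt0 e0 l0).
exists N => k Nk; have [_ ball_k] := HN k Nk.
apply: (@le_lt_trans _ _ (l%:R * (e / l.+1%:R))).
  apply: enorm_le_coord => i; rewrite !mxE distrC ltW //.
  by have := ball_k i 0; rewrite -ball_normE.
by rewrite mulrA ltr_pdivrMr // mulrC ltr_pM2l // ltr_nat.
Qed.

Lemma enorm_cauchy_cvg (R : realType) l (x : nat -> 'cV[R]_l) :
  (forall e, 0 < e -> exists N z, forall k, (N <= k)%N -> enorm (x k - z) < e) ->
  exists y : 'cV[R]_l, x @ \oo --> y.
Proof.
move=> xz; suff /cvg_ex : cvgn x by [].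
apply/cauchy_cvgP; apply: cauchy_exP => e e0.
have [N [z Hz]] := xz e e0; exists z; exists N => // k Nk.
split => // i j; rewrite -ball_normE /= ord1.
apply: le_lt_trans (Hz k Nk).
by apply: le_trans (coord_le_enorm _ i); rewrite !mxE distrC.
Qed.

(** The angle at [p] between [z] and [y] is at least a right angle, so Pythagoras holds as an
    inequality. *)
Lemma obtuse_sqr_dist_le (R : realType) l (y p z : 'cV[R]_l) :
  0 <= dotv (p - z) (y - p) ->
  enorm (p - z) ^+ 2 + enorm (y - p) ^+ 2 <= enorm (y - z) ^+ 2.
Proof.
move=> yzp; have := sqr_enormD (p - z) (y - p).
rewrite (_ : p - z + (y - p) = y - z); last by rewrite addrC subrKA.
move=> ->; lra.
Qed.

Lemma inexact_prox_step (R : realType) l (x x' p u z : 'cV[R]_l) (t : R) :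
  0 <= t <= 6^-1 -> 0 <= dotv (p - z) (x + u - p) ->
  enorm u <= t * enorm (x' - x) -> enorm (x' - p) <= t * enorm (x' - x) ->
  let X := enorm (x - z) in
  [/\ enorm u <= 2 * t * X, enorm (x' - p) <= 2 * t * X,
      enorm (p - z) ^+ 2 + enorm (x + u - p) ^+ 2 <= ((1 + 2 * t) * X) ^+ 2
    & enorm (x' - z) <= (1 + 4 * t) * X].
Proof.
move=> /andP[t0 t6] /obtuse_sqr_dist_le pyth ut x't X.
have X0 : 0 <= X := enorm_ge0 _.
have yz : enorm (x + u - z) <= X + enorm u.
  by rewrite addrAC; exact: enormD_le.
have u0 := enorm_ge0 u; have d0 := enorm_ge0 (x' - x).
have yp : enorm (x + u - p) <= enorm (x + u - z).
  rewrite -(@ler_pXn2r _ 2) ?nnegrE ?enorm_ge0 //.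
  by have := sqr_ge0 (enorm (p - z)); lra.
have pz : enorm (p - z) <= enorm (x + u - z).
  rewrite -(@ler_pXn2r _ 2) ?nnegrE ?enorm_ge0 //.
  by have := sqr_ge0 (enorm (x + u - p)); lra.
have px : enorm (p - x) <= enorm (x + u - p) + enorm u.
  rewrite -enormN (_ : - (p - x) = x + u - p + - u); last first.
    by apply/colP => i; rewrite !mxE; ring.
  by rewrite -(enormN u) enormD_le.
have := enorm_dist_le p x' x => dle.
(* The triangle inequalities give step length at most [X] plus [3 * t] times itself, and [t <= 6^-1]
   absorbs half of it. *)
have d2X : enorm (x' - x) <= 2 * X by nra.
have td : t * enorm (x' - x) <= 2 * t * X by nra.
split; [lra|lra| |].
  apply: le_trans pyth _; rewrite lerXn2r ?nnegrE ?enorm_ge0 //; last lra.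
  by rewrite mulr_ge0 //; lra.
by have := enorm_dist_le p x' z; lra.
Qed.

Lemma geometric_small (R : realType) (c kappa e : R) : 0 < kappa < 1 -> 0 < e ->
  exists N, forall k, (N <= k)%N -> c * kappa ^+ k <= e.
Proof.
move=> /andP[kappa0 kappa1] e0.
have : (fun k => c * kappa ^+ k) @ \oo --> c * 0.
  by apply: cvgM; [exact: cvg_cst | apply: cvg_expr; rewrite gtr0_norm].
rewrite mulr0 => /cvgr0Pnorm_lt /(_ e e0)[N _ HN].
by exists N => k Nk; apply/ltW/(le_lt_trans (ler_norm _))/HN.
Qed.

Lemma geometric_growth_bound (R : realType) (c kappa : R) (X : nat -> R) :
  0 <= c -> 0 < kappa < 1 -> 8 * c / (1 - kappa) <= 1 ->
  (forall k, 0 <= X k) -> (forall k, X k.+1 <= (1 + 4 * (c * kappa ^+ k)) * X k) ->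
  forall k, X k <= 2 * X 0.
Proof.
move=> c0 /andP[kappa0 kappa1] G1 X0 XS.
set G := 8 * c / (1 - kappa) in G1.
have G0 : 0 <= G by rewrite divr_ge0 ?mulr_ge0 //; lra.
have GE : G * (1 - kappa) = 8 * c by rewrite divfK //; lra.
(* The induction carries the partial sums of the geometric series of increments
   [8 * c * kappa ^+ k]; their total [G] is at most 1. *)
have XG k : X k <= X 0%N * (1 + G * (1 - kappa ^+ k)).
  elim: k => [|k IH]; first by rewrite expr0; lra.
  apply: le_trans (XS k) _; rewrite exprS.
  have k0 : 0 <= kappa ^+ k by rewrite exprn_ge0 // ltW.
  have X2 : X k <= 2 * X 0%N.
    by apply: le_trans IH _; have := X0 0%N; have := mulr_ge0 G0 k0; nra.
  have : 4 * (c * kappa ^+ k) * X k <= 4 * (c * kappa ^+ k) * (2 * X 0%N).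
    by rewrite ler_wpM2l // !mulr_ge0.
  have -> : 4 * (c * kappa ^+ k) * (2 * X 0%N) = 8 * c * (kappa ^+ k * X 0%N).
    by ring.
  rewrite -GE; lra.
move=> k; apply: le_trans (XG k) _.
have k0 : 0 <= kappa ^+ k by rewrite exprn_ge0 // ltW.
by have := X0 0%N; have := mulr_ge0 G0 k0; nra.
Qed.

(** A proximal displacement of at least [rho] times the distance to [xs] removes a fixed fraction of
    the squared distance; [s k] is small enough to lose only part of this gain. *)
Lemma linear_rate_of_decrease (R : realType) l (x p y : nat -> 'cV[R]_l)
    (xs : 'cV[R]_l) (rho : R) (s : nat -> R) (N : nat) :
  0 < rho <= 6^-1 ->
  (forall k, (N <= k)%N -> 0 <= s k <= rho ^+ 2 / 10) ->
  (forall k, (N <= k)%N ->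
    [/\ enorm (p k - xs) ^+ 2 + enorm (y k - p k) ^+ 2
          <= ((1 + s k) * enorm (x k - xs)) ^+ 2,
        enorm (x k.+1 - p k) <= s k * enorm (x k - xs)
      & rho * enorm (x k - xs) <= enorm (y k - p k)]) ->
  linear_rate x xs.
Proof.
move=> /andP[rho0 rho6] s_small step.
exists (1 - rho ^+ 2 / 4); first by apply/andP; split; nra.
exists N => // k /= Nk; have /andP[s0 s10] := s_small k Nk.
have [py xp yp] := step k Nk.
have X0 := enorm_ge0 (x k - xs); have P0 := enorm_ge0 (p k - xs).
move: (enorm (x k - xs)) py xp yp X0 => X py xp yp X0.
have yp2 : (rho * X) ^+ 2 <= enorm (y k - p k) ^+ 2.
  by rewrite lerXn2r ?nnegrE ?enorm_ge0 // mulr_ge0 // ltW.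
have rs0 : 0 <= 1 - rho ^+ 2 / 4 - s k by nra.
suff ps : enorm (p k - xs) <= (1 - rho ^+ 2 / 4 - s k) * X.
  by have := enorm_dist_le (p k) (x k.+1) xs; lra.
rewrite -(@ler_pXn2r _ 2) ?nnegrE ?mulr_ge0 //.
apply: le_trans (_ : ((1 + s k) ^+ 2 - rho ^+ 2) * X ^+ 2 <= _).
  by move: py yp2; rewrite !exprMn; lra.
rewrite exprMn ler_wpM2r ?sqr_ge0 //.
by move: (s k) s0 s10 rs0 => s0; nra.
Qed.

(** The abstract argument: the zero set [S] enters through closedness, the obtuse angle inequality
    and the local error bound. *)
Lemma inexact_prox_convergence (R : realType) l (S : set 'cV[R]_l)
    (x p u : nat -> 'cV[R]_l) (sigma : nat -> R) (a tau c kappa M : R) :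
  S !=set0 ->
  (forall y, (forall e : R, 0 < e -> exists2 z, S z & enorm (y - z) < e) -> S y) ->
  0 < kappa < 1 -> 0 <= c -> 0 <= a -> 0 < tau ->
  (forall k, 0 < sigma k <= M) ->
  (forall k z, S z -> 0 <= dotv (p k - z) (x k + u k - p k)) ->
  (forall k, enorm (u k) <= c * kappa ^+ k * enorm (x k.+1 - x k)) ->
  (forall k, enorm (x k.+1 - p k) <= c * kappa ^+ k * enorm (x k.+1 - x k)) ->
  (forall k, sigma k * enorm (x k + u k - p k) < tau -> exists2 z, S z &
     enorm (p k - z) <= a * (sigma k * enorm (x k + u k - p k))) ->
  exists2 xs, S xs & [/\ x @ \oo --> xs, linear_rate x xs
                       & sigma @ \oo --> (0 : R) -> superlinear_rate x xs].
Proof.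
move=> [z0 Sz0] S_closed kappa01 c0 a0 tau0 sigmaM mono uc pc err.
have /andP[kappa0 kappa1] := kappa01.
have M0 : 0 < M by have /andP[/lt_le_trans] := sigmaM 0%N; exact.
pose t k := c * kappa ^+ k.
have t0 k : 0 <= t k by rewrite mulr_ge0 // exprn_ge0 // ltW.
have t_small e : 0 < e -> exists N, forall k, (N <= k)%N -> t k <= e.
  exact: geometric_small.
(* From [k0] on, the one-step estimate applies, and the geometric growth bound can be started at any
   index, with [t k] in the place of [c]. *)
have [k0 tk0] : exists k0, forall k, (k0 <= k)%N ->
    t k <= 12^-1 /\ 8 * t k / (1 - kappa) <= 1.
  have [|k1 Hk1] := t_small (Num.min 12^-1 ((1 - kappa) / 8)).
    by rewrite lt_min invr_gt0 ltr0n divr_gt0 ?subr_gt0.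
  exists k1 => k /Hk1; rewrite le_min => /andP[-> ?]; split=> //.
  by rewrite ler_pdivrMr ?subr_gt0 //; lra.
have step k z : (k0 <= k)%N -> S z -> let X := enorm (x k - z) in
  [/\ enorm (u k) <= 2 * t k * X, enorm (x k.+1 - p k) <= 2 * t k * X,
      enorm (p k - z) ^+ 2 + enorm (x k + u k - p k) ^+ 2
        <= ((1 + 2 * t k) * X) ^+ 2
    & enorm (x k.+1 - z) <= (1 + 4 * t k) * X].
  move=> k0k Sz; apply: inexact_prox_step; [|exact: mono|exact: uc|exact: pc].
  by rewrite t0 /=; have [? _] := tk0 k k0k; lra.
have fejer k j z : (k0 <= k)%N -> (k <= j)%N -> S z ->
    enorm (x j - z) <= 2 * enorm (x k - z).
  move=> k0k kj Sz; rewrite -(subnKC kj); move: (j - k)%N.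
  have -> : enorm (x k - z) = enorm (x (k + 0)%N - z) by rewrite addn0.
  apply: (@geometric_growth_bound R (t k) kappa
    (fun j => enorm (x (k + j)%N - z))) => //.
  - by have [] := tk0 k k0k.
  - by move=> i; exact: enorm_ge0.
  move=> i; rewrite /t -mulrA -exprD addnS.
  by have [] := step (k + i)%N z (leq_trans k0k (leq_addr _ _)) Sz.
pose q k := enorm (x k + u k - p k).
have q_small e : 0 < e -> exists N, forall k, (N <= k)%N -> q k < e.
  pose X k := enorm (x (k0 + k)%N - z0).
  pose B := 2 * X 0%N.
  have XB k : X k <= B by rewrite /B /X addn0 fejer // leq_addr.
  have X0 k : 0 <= X k by exact: enorm_ge0.
  (* The added term decreases by exactly [20 * B ^+ 2 * t (k0 + k)] per step, which pays for the
     inexactness in the decrease of [X k ^+ 2]. *)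
  pose b k := X k ^+ 2 + 20 * B ^+ 2 * t (k0 + k)%N / (1 - kappa).
  move=> e0.
  have [||N HN] := @telescoping_bound_to0 R b (fun k => q (k0 + k)%N) _ _ e e0.
  - move=> k; rewrite /b addr_ge0 ?sqr_ge0 // divr_ge0 ?subr_ge0 ?(ltW kappa1) //.
    by rewrite mulr_ge0 // mulr_ge0 ?sqr_ge0.
  - move=> k; have [t12 _] := tk0 (k0 + k)%N (leq_addr _ _).
    have [_ xp pq _] := step (k0 + k)%N z0 (leq_addr _ _) Sz0.
    rewrite /b; have -> : t (k0 + k.+1)%N = kappa * t (k0 + k)%N.
      by rewrite /t addnS exprS; ring.
    rewrite (_ : _ - _ = X k ^+ 2 - X k.+1 ^+ 2 + 20 * B ^+ 2 * t (k0 + k)%N);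
      last by field; lra.
    have := enorm_dist_le (p (k0 + k)%N) (x (k0 + k).+1) z0; rewrite -addnS.
    rewrite -/(X k.+1) => Xp.
    have P0 := enorm_ge0 (p (k0 + k)%N - z0).
    move: pq xp Xp; rewrite -/(q (k0 + k)%N) -/(X k) -addnS.
    have X2 : X k ^+ 2 * t (k0 + k)%N <= B ^+ 2 * t (k0 + k)%N.
      by rewrite ler_wpM2r // lerXn2r ?nnegrE //; apply: le_trans (XB k).
    have := X0 k; have := X0 k.+1; have := t0 (k0 + k)%N.
    move: (t _) (enorm (p _ - z0)) (enorm (x _ - p _)) (q _) (X k) (X k.+1)
      t12 P0 X2 => T P E Q Xk Xk1 T12 P0 X2 T0 Xk10 Xk0 pq xp Xp.
    have Pb : P <= 2 * Xk.
      rewrite -(@ler_pXn2r _ 2) ?nnegrE ?mulr_ge0 //.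
      apply: le_trans (_ : ((1 + 2 * T) * Xk) ^+ 2 <= _).
        by have := sqr_ge0 Q; lra.
      by rewrite lerXn2r ?nnegrE ?mulr_ge0 //; nra.
    have : Xk1 ^+ 2 <= (2 * T * Xk + P) ^+ 2.
      by rewrite lerXn2r ?nnegrE ?addr_ge0 ?mulr_ge0 //; lra.
    have TXP : T * Xk * P <= T * Xk * (2 * Xk) by rewrite ler_wpM2l // mulr_ge0.
    have TTX : T * (T * Xk ^+ 2) <= 12^-1 * (T * Xk ^+ 2).
      by rewrite ler_wpM2r // mulr_ge0 ?sqr_ge0.
    have := mulr_ge0 T0 (sqr_ge0 Xk).
    move: pq X2 TXP TTX; rewrite !expr2; nra.
  exists (k0 + N)%N => k Nk.
  have k0k : (k0 <= k)%N := leq_trans (leq_addr _ _) Nk.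
  by rewrite -(subnKC k0k); apply: HN; rewrite leq_subRL.
have [k1 Hk1] := q_small (tau / M) (divr_gt0 tau0 M0).
have near_sol k : (k1 <= k)%N -> exists2 z, S z &
    enorm (p k - z) <= a * (sigma k * q k).
  move=> /Hk1 qk; apply: err; have /andP[sk skM] := sigmaM k.
  apply: le_lt_trans (_ : M * q k < _); first by rewrite ler_wpM2r ?enorm_ge0.
  by rewrite mulrC -ltr_pdivlMr.
(* Both parts of the distance from [x k.+1] to [z], namely [2 * t k * B] and [a * M * q k], are
   brought below [e / 2]. *)
have near_S (e : R) : 0 < e -> exists N z, [/\ (k0 <= N)%N, S z & enorm (x N - z) < e].
  move=> e0; pose B := 2 * enorm (x k0 - z0).
  have B0 : 0 <= B by rewrite mulr_ge0 ?enorm_ge0.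
  have aM0 : 0 <= a * M by rewrite mulr_ge0 // ltW.
  have B1 : 0 < 4 * (B + 1) by rewrite mulr_gt0 //; lra.
  have aM1 : 0 < 2 * (a * M + 1) by rewrite mulr_gt0 //; lra.
  have [k2 Hk2] := t_small (e / (4 * (B + 1))) (divr_gt0 e0 B1).
  have [k3 Hk3] := q_small (e / (2 * (a * M + 1))) (divr_gt0 e0 aM1).
  pose k := maxn (maxn k0 k1) (maxn k2 k3).
  have k0k : (k0 <= k)%N by rewrite /k !leq_max leqnn.
  have k1k : (k1 <= k)%N by rewrite /k !leq_max leqnn !orbT.
  have k2k : (k2 <= k)%N by rewrite /k !leq_max leqnn !orbT.
  have k3k : (k3 <= k)%N by rewrite /k !leq_max leqnn !orbT.
  have := Hk2 k k2k; rewrite ler_pdivlMr // => tk.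
  have := Hk3 k k3k; rewrite ltr_pdivlMr // => qk.
  have [z Sz pz] := near_sol k k1k.
  exists k.+1, z; split=> //; first exact: leqW.
  have [_ xp _ _] := step k z0 k0k Sz0.
  have XB : enorm (x k - z0) <= B by exact: fejer.
  have := enorm_dist_le (p k) (x k.+1) z.
  have tX : t k * enorm (x k - z0) <= t k * B by rewrite ler_wpM2l.
  have /andP[sk skM] := sigmaM k.
  have q0 : 0 <= q k := enorm_ge0 _.
  have : a * (sigma k * q k) <= a * (M * q k) by rewrite ler_wpM2l // ler_wpM2r.
  have := t0 k; lra.
(* Once an iterate is within [e / 2] of a zero, [fejer] keeps the whole tail within [e] of it. *)
have [xs x_xs] : exists xs : 'cV[R]_l, x @ \oo --> xs.
  apply: enorm_cauchy_cvg => e e0.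
  have [|N [z [k0N Sz xz]]] := near_S (e / 2); first by rewrite divr_gt0.
  exists N, z => k Nk; have := fejer N k z k0N Nk Sz; lra.
have x_near := enorm_cvg x_xs.
have Sxs : S xs.
  apply: S_closed => e e0.
  have [|N [z [k0N Sz xz]]] := near_S (e / 4); first by rewrite divr_gt0.
  have [|k Hk] := x_near (e / 4); first by rewrite divr_gt0.
  exists z => //.
  have := fejer N (maxn N k) z k0N (leq_maxl _ _) Sz.
  have := Hk (maxn N k) (leq_maxr _ _).
  have := enorm_dist_le (x (maxn N k)) xs z.
  rewrite (enorm_distC xs (x _)).
  lra.
(* Go from [x k] through [z] to a late iterate close to [xs]; by [fejer] the second leg is at most
   twice the first. *)
have dist_xs k z : (k0 <= k)%N -> S z -> enorm (x k - xs) <= 3 * enorm (x k - z).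
  move=> k0k Sz; apply/ler_addgt0Pr => e e0.
  have [N HN] := x_near e e0.
  have := fejer k (maxn k N) z k0k (leq_maxl _ _) Sz.
  have := HN (maxn k N) (leq_maxr _ _).
  have := enorm_dist_le (x (maxn k N)) z xs.
  have := enorm_dist_le z (x k) xs.
  rewrite (enorm_distC z (x _)); lra.
exists xs => //; split=> //.
  have aM0 : 0 <= a * M by rewrite mulr_ge0 // ltW.
  (* [dist_xs] bounds the distance by [3 * (enorm (u k) + (1 + a * M) * q k)]; as [enorm (u k)] is
     at most a sixth of the distance, half of the distance is absorbed, leaving [Q * q k]. *)
  pose Q := 6 * (1 + a * M); have Q6 : 6 <= Q by rewrite /Q; lra.
  have Q0 : 0 < Q by lra.
  have [|N HN] := t_small (Q^-1 ^+ 2 / 20).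
    by rewrite divr_gt0 // exprn_gt0 // invr_gt0.
  pose N' := maxn N (maxn k0 k1).
  apply: (@linear_rate_of_decrease R l x p (fun k => x k + u k) xs Q^-1
    (fun k => 2 * t k) N').
  - by rewrite invr_gt0 Q0 lef_pV2 ?posrE.
  - move=> k; rewrite geq_max => /andP[/HN tk _].
    by rewrite mulr_ge0 //=; lra.
  move=> k; rewrite !geq_max => /and3P[Nk k0k k1k].
  have [uX xp pq _] := step k xs k0k Sxs; split=> //.
  rewrite ler_pdivrMl //.
  have [z Sz pz] := near_sol k k1k.
  have X3 := dist_xs k z k0k Sz.
  have [t12 _] := tk0 k k0k.
  have X0 := enorm_ge0 (x k - xs).
  have /andP[sk skM] := sigmaM k.
  have q0 : 0 <= q k := enorm_ge0 _.
  have aq : a * (sigma k * q k) <= a * (M * q k).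
    by rewrite ler_wpM2l // ler_wpM2r.
  have xz : enorm (x k - z) <= enorm (u k) + q k + enorm (p k - z).
    rewrite -(enormN (u k)).
    apply: le_trans (enorm_dist_le (p k) _ _) _; rewrite lerD2r.
    apply: le_trans _ (enormD_le _ _).
    by rewrite (_ : - u k + _ = x k - p k) //; apply/colP => i; rewrite !mxE; ring.
  have tX : t k * enorm (x k - xs) <= 12^-1 * enorm (x k - xs).
    by rewrite ler_wpM2r.
  by rewrite -/(q k) /Q; lra.
move=> sigma0 r r0.
(* The inexactness and the error bound each contribute at most [r / 6] times the distance; the
   factor 3 of [dist_xs] turns their sum into [r]. *)
have a1 : 0 < 12 * (a + 1) by rewrite mulr_gt0 //; lra.
have [|N HN] := t_small (r / 12); first by rewrite divr_gt0.
have /cvgr0Pnorm_lt /(_ (r / (12 * (a + 1))) (divr_gt0 r0 a1))[N' _ HN'] := sigma0.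
exists (maxn (maxn N N') (maxn k0 k1)) => //= k /=.
rewrite !geq_max => /andP[/andP[Nk N'k] /andP[k0k k1k]].
have [z Sz pz] := near_sol k k1k.
have X3 := dist_xs k.+1 z (leqW k0k) Sz.
have [_ xp pq _] := step k xs k0k Sxs.
have := HN' k N'k; have /andP[sk skM] := sigmaM k; rewrite /= gtr0_norm //.
rewrite ltr_pdivlMr // => ska.
have := HN k Nk => tk.
have [t12 _] := tk0 k k0k.
have X0 := enorm_ge0 (x k - xs).
have q0 : 0 <= q k := enorm_ge0 _.
have qX : q k <= 2 * enorm (x k - xs).
  rewrite -(@ler_pXn2r _ 2) ?nnegrE ?mulr_ge0 //.
  apply: le_trans (_ : ((1 + 2 * t k) * enorm (x k - xs)) ^+ 2 <= _).
    by have := sqr_ge0 (enorm (p k - xs)); rewrite /q; lra.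
  have tX0 : 0 <= (1 + 2 * t k) * enorm (x k - xs).
    by rewrite mulr_ge0 // addr_ge0 // mulr_ge0.
  have tX2 : (1 + 2 * t k) * enorm (x k - xs) <= 2 * enorm (x k - xs).
    by rewrite ler_wpM2r //; lra.
  by rewrite lerXn2r ?nnegrE // (le_trans tX0).
have := enorm_dist_le (p k) (x k.+1) z.
have tX : t k * enorm (x k - xs) <= r / 12 * enorm (x k - xs).
  by rewrite ler_wpM2r.
have as12 : a * sigma k <= r / 12 by nra.
have : a * sigma k * q k <= r / 12 * (2 * enorm (x k - xs)).
  by apply: ler_pM => //; rewrite mulr_ge0 // ltW.
lra.
Qed.

(** * The proximal subproblems of the quadratic program *)

Lemma pfbC (R : realType) (alpha a b : R) : pfb alpha a b = pfb alpha b a.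
Proof.
by rewrite /pfb (addrC a) (addrC (a ^+ 2)) (mulrC (Num.max a 0)).
Qed.

(** Let [a <= b]. If [a] is nonnegative, the square root is at most [a / 2 + b] and the product term
    only helps; if [a] is negative, the product vanishes and the square root is at least [b]. *)
Lemma min_le_pfb (R : realType) (alpha a b : R) : 0 < alpha < 1 ->
  `|Num.min a b| <= 2 / alpha * `|pfb alpha a b|.
Proof.
move=> /andP[alpha0 alpha1].
wlog ab : a b / a <= b.
  move=> wlog_ab; have [/wlog_ab//|/wlog_ab] := orP (le_total a b).
  by rewrite pfbC minC.
rewrite mulrAC ler_pdivlMr // (min_idPl ab) /pfb.
set s := Num.sqrt _.
have [a0|a0] := leP 0 a.
  rewrite (max_idPl (le_trans a0 ab)) ger0_norm //.
  have s_le : s <= a / 2 + b.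
    rewrite -(@ler_pXn2r _ 2) ?nnegrE ?sqrtr_ge0 //; last lra.
    by rewrite sqr_sqrtr ?addr_ge0 ?sqr_ge0 //; nra.
  apply: le_trans (_ : 2 * (alpha * (a + b - s) + (1 - alpha) * (a * b)) <= _).
    have : alpha * (a / 2) <= alpha * (a + b - s) by rewrite ler_pM2l //; lra.
    have : 0 <= (1 - alpha) * (a * b).
      by rewrite !mulr_ge0 // ?(le_trans a0 ab) // subr_ge0 ltW.
    lra.
  by rewrite ler_pM2l // ler_norm.
have s_ge : b <= s.
  apply: le_trans (ler_norm _) _; rewrite -sqrtr_sqr ler_wsqrtr //.
  by rewrite lerDr sqr_ge0.
rewrite mul0r mulr0 addr0 normrM (gtr0_norm alpha0) (ltr0_norm a0).
have : - a <= `|a + b - s| by rewrite ler0_norm; lra.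
nra.
Qed.

Definition sign_constrained (n m q : nat) (i : 'I_(n + m + q)) : bool :=
  (n + m <= i)%N.

Lemma sign_constrained_lshift (n m q : nat) (i : 'I_(n + m)) :
  sign_constrained (lshift q i) = false.
Proof. by rewrite /sign_constrained /= leqNgt ltn_ord. Qed.

Lemma sign_constrained_rshift (n m q : nat) (i : 'I_q) :
  sign_constrained (rshift (n + m) i) = true.
Proof. by rewrite /sign_constrained /= leq_addr. Qed.

Lemma kktCE (R : realType) (n m q : nat) (x : 'cV[R]_(n + m + q)) :
  kktC x <-> forall i, sign_constrained i -> 0 <= x i 0.
Proof.
split=> [Cx i|x0 i]; last by rewrite mxE x0 // sign_constrained_rshift.
have [j ->|j ->] := split_ordP i; first by rewrite sign_constrained_lshift.
by move=> _; have := Cx j; rewrite mxE.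
Qed.

Lemma kkt_splitE (R : realType) (n m q : nat) (x : 'cV[R]_(n + m + q)) :
  x = col_mx (col_mx (zpart x) (lpart x)) (vpart x).
Proof. by rewrite !vsubmxK. Qed.

Lemma kktK_mulE (R : realType) (n m q : nat) (P : qp_data R n m q)
    (x : 'cV[R]_(n + m + q)) :
  kktK P *m x = col_mx
    (col_mx (qpH P *m zpart x + (qpG P)^T *m lpart x + (qpA P)^T *m vpart x)
            (- (qpG P *m zpart x)))
    (- (qpA P *m zpart x)).
Proof.
rewrite {1}(kkt_splitE x) /kktK !mul_block_col mul_col_mx mul_row_col.
by rewrite !mul0mx !addr0 !mulNmx add_col_mx addr0.
Qed.

(** Exhibits the block residual as a coordinatewise reformulation of the proximal inclusion, with
    slack [g]. *)
Lemma prox_resE (R : realType) (n m q : nat) (P : qp_data R n m q)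
    (alpha sigma : R) (xbar x : 'cV[R]_(n + m + q)) (i : 'I_(n + m + q)) :
  let g := kktF P x + sigma *: (x - xbar) in
  prox_res P alpha xbar sigma x i 0
  = if sign_constrained i then pfb alpha (g i 0) (x i 0) else g i 0.
Proof.
have -> : kktF P x + sigma *: (x - xbar) = col_mx
    (col_mx (qpH P *m zpart x + qpf P + (qpG P)^T *m lpart x
               + (qpA P)^T *m vpart x + sigma *: (zpart x - zpart xbar))
            (qph P - qpG P *m zpart x + sigma *: (lpart x - lpart xbar)))
    (qpb P - qpA P *m zpart x + sigma *: (vpart x - vpart xbar)).
  rewrite /kktF kktK_mulE /kktw !add_col_mx.
  rewrite [x - xbar]kkt_splitE !scale_col_mx !add_col_mx.
  rewrite /zpart /lpart /vpart !linearB /=.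
  congr (col_mx (col_mx (_ + _) (_ + _)) (_ + _)); rewrite 1?addrC //.
  by rewrite !addrA (addrC (qpf P)).
rewrite /prox_res /=; have [j ->|j ->] := split_ordP i.
  by rewrite sign_constrained_lshift !col_mxEu.
rewrite sign_constrained_rshift !col_mxEd mxE; congr pfb.
by rewrite mxE.
Qed.

Lemma dotv_col_mx (R : realType) (k l : nat) (a c : 'cV[R]_k) (b d : 'cV[R]_l) :
  dotv (col_mx a b) (col_mx c d) = dotv a c + dotv b d.
Proof.
rewrite /dotv big_split_ord; congr (_ + _); apply: eq_bigr => i _.
  by rewrite !col_mxEu.
by rewrite !col_mxEd.
Qed.

Lemma dotv_mulmx_tr (R : realType) (k l : nat) (A : 'M[R]_(k, l))
    (u : 'cV[R]_l) (v : 'cV[R]_k) : dotv u (A^T *m v) = dotv v (A *m u).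
Proof.
have dotvE p (a b : 'cV[R]_p) : dotv a b = (a^T *m b) 0 0.
  by rewrite mxE; apply: eq_bigr => i _; rewrite mxE.
by rewrite dotvC !dotvE trmx_mul trmxK mulmxA.
Qed.

(** The off-diagonal blocks are skew and cancel in the quadratic form, which leaves that of
    [qpH P]. *)
Lemma kktK_monotone (R : realType) (n m q : nat) (P : qp_data R n m q) :
  convex_qp P -> forall x, 0 <= dotv x (kktK P *m x).
Proof.
move=> [_ H0] x; rewrite kktK_mulE {1}(kkt_splitE x) !dotv_col_mx.
rewrite !dotvDr !dotvNr !dotv_mulmx_tr; have := H0 (zpart x); lra.
Qed.

Lemma kkt_zerosE (R : realType) (n m q : nat) (P : qp_data R n m q)
    (x : 'cV[R]_(n + m + q)) :
  kkt_zeros P x <-> mlcp (@sign_constrained n m q) (kktK P) (kktw P) 0 x.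
Proof.
rewrite /kkt_zeros /kktT /= /mlcp subr0 -/(kktF P x); split.
  move=> [w [/kktCE x0 wN] /eqP]; rewrite addrC addr_eq0 => /eqP wF k.
  (* The normal cone inequality is tested at [x] moved along one coordinate; [s] will be [x k 0],
     [- 1] or [1]. *)
  have test s : (sign_constrained k -> s <= x k 0) -> 0 <= s * w k 0.
    move=> sx; have := wN (x - s *: delta_mx k 0); rewrite subKr.
    have -> : dotv (s *: delta_mx k 0) w = s * w k 0.
      rewrite dotvZl /dotv (bigD1 k) //= !mxE !eqxx mul1r big1 ?addr0 // => j jk.
      by rewrite mxE (negbTE jk) mul0r.
    apply; apply/kktCE => i Ji; rewrite !mxE.
    have [ik|ik] := eqVneq i k; last by rewrite mulr0 subr0 x0.
    by rewrite ik mulr1 subr_ge0 sx // -ik.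
  have FE : kktF P x k 0 = - w k 0 by rewrite wF [X in _ = - X]mxE opprK.
  case Jk: (sign_constrained k) in test *.
    have x0k := x0 k Jk; rewrite FE.
    have xw : 0 <= x k 0 * w k 0 by apply: test.
    have w0 : 0 <= - 1 * w k 0 by apply: test => _; lra.
    have := mulr_ge0 x0k w0.
    by split=> //; [lra|apply/le_anti/andP; split; lra].
  have w0 : 0 <= 1 * w k 0 by apply: test.
  have w1 : 0 <= - 1 * w k 0 by apply: test.
  by rewrite FE; apply/le_anti/andP; split; lra.
move=> xP; exists (- kktF P x); last by rewrite subrr.
split; first by apply/kktCE => i Ji; have := xP i; rewrite Ji => -[].
move=> y /kktCE y0; rewrite dotvNr oppr_ge0; apply: sumr_le0 => i _.
have -> : (x - y) i 0 = x i 0 - y i 0 by rewrite !mxE.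
have := xP i; case: ifP => [Ji [x0 F0 xF]|_ ->]; last by rewrite mulr0.
have := mulr_ge0 (y0 i Ji) F0; lra.
Qed.

(** * From the exit test of EvalProx to exact steps with perturbed data *)

Lemma evalprox_residual (R : realType) (n m q : nat) (P : qp_data R n m q)
    (alpha beta eta eps sigma : R) (xbar x y : 'cV[R]_(n + m + q)) :
  evalprox_from P alpha beta eta xbar eps sigma x y ->
  prox_res P alpha xbar sigma y = 0 \/
  enorm (prox_res P alpha xbar sigma y) <= eps * Num.min 1 (enorm (y - xbar)).
Proof.
by elim=> {x y} [x res0|x x' _ _ stop|//]; [left | right].
Qed.

(** The initial value is at most 1 and every update gains a factor [kappa]; this decay makes the
    errors of the outer loop summable. *)
Lemma fbstab_delta_le (R : realType) (n m q : nat) (P : qp_data R n m q)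
    (kappa : R) (sigma : nat -> R) (x : nat -> 'cV[R]_(n + m + q)) (k : nat) :
  0 < kappa < 1 -> fbstab_delta P kappa sigma x k <= kappa ^+ k.
Proof.
move=> /andP[kappa0 kappa1]; elim: k => [|k IH] /=.
  rewrite expr0 ge_min; apply/orP; left.
  have : fbstab_delta0 P sigma x <= 1 by rewrite ge_min lexx orbT.
  nra.
by rewrite ge_min exprS ler_wpM2l // ltW.
Qed.

(* The natural residual [r] of the proximal subproblem is bounded by its
   penalized Fischer-Burmeister residual, and [p = y - r] solves the
   subproblem exactly after a perturbation of order [r]. *)
Lemma prox_res_approx (R : realType) (n m q : nat) (P : qp_data R n m q)
    (alpha : R) : 0 < alpha < 1 ->
  exists2 c : R, 0 <= c & forall (sigma : R) (xbar y : 'cV[R]_(n + m + q)),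
    0 < sigma -> exists p e : 'cV[R]_(n + m + q),
    let res := enorm (prox_res P alpha xbar sigma y) in
    [/\ mlcp (@sign_constrained n m q) (kktK P) (kktw P)
          (sigma *: (xbar - p) + e) p,
        enorm (y - p) <= c * res & enorm e <= c * (1 + sigma) * res].
Proof.
move=> alpha01; have /andP[alpha0 alpha1] := alpha01.
have [B B0 KB] := enorm_mulmx_le (kktK P).
(* The factor [2 / alpha] comes from [min_le_pfb] and exceeds 1, so it also serves the unconstrained
   coordinates; the dimension passes from coordinates to the norm. *)
pose c := (n + m + q)%:R * (2 / alpha).
have c0 : 0 <= c by rewrite mulr_ge0 // divr_ge0 // ltW.
exists (c * (1 + B)) => [|sigma xbar y sigma0].
  by rewrite mulr_ge0 //; lra.
pose g := kktF P y + sigma *: (y - xbar).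
pose r := \col_i (if sign_constrained i then Num.min (g i 0) (y i 0) else g i 0).
set res := enorm (prox_res P alpha xbar sigma y).
have res0 : 0 <= res := enorm_ge0 _.
have rc : enorm r <= c * res.
  rewrite -mulrA; apply: enorm_le_coord => i; rewrite mxE.
  have := coord_le_enorm (prox_res P alpha xbar sigma y) i; rewrite prox_resE -/g -/res.
  case: ifP => _ ri.
    by apply: le_trans (min_le_pfb _ _ alpha01) _; rewrite ler_wpM2l // divr_ge0 // ltW.
  apply: le_trans ri _; rewrite ler_peMl // ler_pdivlMr //; lra.
(* Chosen so that the slack at [y - r] is exactly [g - r]; where [r] is the minimum of [g] and [y],
   both [y - r] and [g - r] are nonnegative and one of them vanishes. *)
pose e := r - kktK P *m r - sigma *: r.
have r0 := enorm_ge0 r.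
have cB : c * res <= c * (1 + B) * res by rewrite ler_wpM2r // ler_peMr //; lra.
exists (y - r), e; split; last 2 first.
- by rewrite subKr; lra.
- have eB : enorm e <= enorm r + B * enorm r + sigma * enorm r.
    apply: le_trans (enormD_le _ _) _; rewrite enormN enormZ gtr0_norm // lerD2r.
    by apply: le_trans (enormD_le _ _) _; rewrite enormN lerD2l.
  apply: le_trans eB _; apply: le_trans (_ : (1 + B) * (1 + sigma) * enorm r <= _).
    by have := mulr_ge0 (mulr_ge0 B0 (ltW sigma0)) r0; lra.
  rewrite (_ : c * _ * _ * _ = (1 + B) * (1 + sigma) * (c * res)); last by ring.
  by rewrite ler_wpM2l // mulr_ge0 //; lra.
have gE : kktK P *m (y - r) + kktw P - (sigma *: (xbar - (y - r)) + e) = g - r.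
  rewrite /g /kktF /e mulmxBr; apply/colP => k; rewrite !mxE; ring.
rewrite /mlcp gE => k.
have subE (u v : 'cV[R]_(n + m + q)) : (u - v) k 0 = u k 0 - v k 0 by rewrite !mxE.
rewrite (subE g) (subE y) [r k 0]mxE.
case: (sign_constrained k); last by rewrite subrr.
by have [gy|gy] := leP (g k 0) (y k 0); split; rewrite ?subrr ?mulr0 ?mul0r //; lra.
Qed.

Theorem theorem3 (R : realType) (n m q : nat) (P : qp_data R n m q)
    (alpha beta eta kappa : R) (sigma : nat -> R)
    (x0 : 'cV[R]_(n + m + q)) (x : nat -> 'cV[R]_(n + m + q))
    (Pconvex : convex_qp P)
    (alpha01 : 0 < alpha < 1) (beta01 : 0 < beta < 1)
    (eta_range : 0 < eta < 2^-1) (kappa01 : 0 < kappa < 1)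
    (sigma_gt0 : forall k, 0 < sigma k)
    (sigma_bounded : exists M : R, forall k, sigma k <= M)
    (zeros_neq0 : kkt_zeros P !=set0)
    (x_fbstab : fbstab_sequence P alpha beta eta kappa sigma x0 x) :
  exists2 xstar : 'cV[R]_(n + m + q), kkt_zeros P xstar &
    [/\ x @ \oo --> xstar,
        linear_rate x xstar
      & sigma @ \oo --> (0 : R) -> superlinear_rate x xstar].
Proof.
have [Mb sigma_le] := sigma_bounded.
have /andP[kappa0 kappa1] := kappa01.
have sigmaM k : 0 < sigma k <= Mb by rewrite sigma_gt0 sigma_le.
have M0 : 0 < Mb by have /andP[/lt_le_trans] := sigmaM 0%N; exact.
pose J := @sign_constrained n m q.
have [c c0 approx] := prox_res_approx P alpha01.
have [a [tau [a0 tau0 err]]] := mlcp_error_bound J (kktK P) (kktw P).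
pose C := c * (1 + Mb).
have C0 : 0 <= C by rewrite mulr_ge0 //; lra.
pose d k := kappa ^+ k * enorm (x k.+1 - x k).
have d0 k : 0 <= d k by rewrite mulr_ge0 ?enorm_ge0 // exprn_ge0 // ltW.
have /choice[p] : forall k, exists p, exists u,
    [/\ mlcp J (kktK P) (kktw P) (sigma k *: (x k + u - p)) p,
        enorm u <= C * d k & enorm (x k.+1 - p) <= C * d k].
  move=> k; have [_ /(_ k)[stop next]] := x_fbstab.
  have [xkS|/next {stop next}] := pselect (kkt_zeros P (x k)).
    (* After termination the iterate is its own exact proximal point. *)
    exists (x k), 0; rewrite addr0 (stop xkS) subrr scaler0 enorm0.
    have Cd0 : 0 <= C * d k by rewrite mulr_ge0.
    by split=> //; apply/kkt_zerosE.
  move=> /evalprox_residual res_or.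
  have [p [e [pe yp ee]]] := approx (sigma k) (x k) (x k.+1) (sigma_gt0 k).
  set res := enorm (prox_res _ _ _ _ _) in yp ee.
  have res_le : res <= sigma k * d k.
    have s0 := ltW (sigma_gt0 k).
    case: res_or => [res0|/le_trans]; first by rewrite /res res0 enorm0 mulr_ge0.
    apply; set D := enorm _.
    have D0 : 0 <= D := enorm_ge0 _.
    apply: le_trans (_ : kappa ^+ k * sigma k * Num.min 1 D <= _).
      by rewrite !ler_wpM2r ?le_min ?ler01 // fbstab_delta_le.
    rewrite /d -/D mulrA [sigma k * _]mulrC ler_wpM2l ?ge_min ?lexx ?orbT //.
    by rewrite mulr_ge0 // exprn_ge0 // ltW.
  have /andP[s0 sM] := sigmaM k.
  (* Moving the perturbation [e] into the proximal centre divides it by [sigma k], which the factor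
     [sigma k] in the EvalProx tolerance compensates. *)
  exists p, ((sigma k)^-1 *: e); split.
  - rewrite addrAC scalerDr scalerA divff ?gt_eqF // scale1r; exact: pe.
  - rewrite enormZ gtr0_norm ?invr_gt0 // ler_pdivrMl //.
    apply: le_trans ee _; apply: le_trans (_ : C * res <= _).
      by rewrite ler_wpM2r ?enorm_ge0 // ler_wpM2l //; lra.
    by rewrite mulrCA ler_wpM2l.
  apply: le_trans yp _; rewrite -mulrA ler_wpM2l //.
  by apply: le_trans res_le _; rewrite ler_wpM2r //; lra.
move=> /choice[u step].
apply: (@inexact_prox_convergence R _ (kkt_zeros P) x p u sigma a tau C kappa Mb)
  => //.
- move=> y near_y; apply/kkt_zerosE; apply: mlcp_closed => e /near_y[z zS yz].
  by exists z => //; apply/kkt_zerosE.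
- move=> k z /kkt_zerosE zS; have [pk _ _] := step k.
  have := mlcp_monotone (kktK_monotone Pconvex) pk zS.
  by rewrite subr0 dotvZr pmulr_rge0.
- by move=> k; have [_ + _] := step k; rewrite /d mulrA.
- by move=> k; have [_ _] := step k; rewrite /d mulrA.
move=> k small; have [pk _ _] := step k.
have wE : enorm (sigma k *: (x k + u k - p k))
    = sigma k * enorm (x k + u k - p k) by rewrite enormZ gtr0_norm.
have [|z zS pz] := err _ _ pk; first by rewrite wE.
by exists z; [apply/kkt_zerosE | rewrite -wE].
Qed.
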